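(* Let $K$ be a field of characteristic $p>0$ and $s\ge1$. For $u=(u_{ik})\in\mathcal{M}_{n,s}$ define elements of $\mathcal{D}_n$: $y_{u,i}^{[0]}=1$, $y_{u,i}^{[1]}=\partial_i^{[p^s]}+u_{i0}$, recursively for $k\ge1$ $y_{u,i}^{[p^k]}=u_{ik}+\int_i^{*p^s}\prod_{l=0}^{k-1}\frac{(y_{u,i}^{[p^l]})^{p-1}}{(p-1)!}$, for $j=\sum_kj_kp^k$ ($0\le j_k<p$) $y_{u,i}^{[j]}=\prod_k\frac{(y_{u,i}^{[p^k]})^{j_k}}{j_k!}$, and $y_u^{[\alpha]}=\prod_{i=1}^ny_{u,i}^{[\alpha_i]}$ for $\alpha\in\mathbb{N}^n$. Then the map $u\mapsto y_u=\{y_u^{[\alpha]}\}_{\alpha\in\mathbb{N}^n}$ is a bijection from $\mathcal{M}_{n,s}$ onto the set $\mathrm{ID}(\delta^{p^s},\mathcal{D}_n)$, and its inverse sends $z=\{z^{[\alpha]}\}$ to $u=(u_{ik})$ with $u_{ik}=z_i^{[p^k]}-\int_i^{*p^s}z_i^{[p^k-1]}$, where $z_i^{[j]}:=z^{[je_i]}$.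
   Context: $P_n=K[x_1,\ldots,x_n]$; $\partial_i^{[k]}=\partial_i^k/k!$, $\partial^{[\alpha]}=\prod_i\partial_i^{[\alpha_i]}$; $\mathcal{D}_n=\bigoplus_{\alpha\in\mathbb{N}^n}K\partial^{[\alpha]}$ is the commutative algebra of scalar differential operators, with $\partial^{[\alpha]}\partial^{[\beta]}=\binom{\alpha+\beta}{\beta}\partial^{[\alpha+\beta]}$. Let $\delta_i=-\mathrm{ad}(x_i)$ (inner derivation of the ring of differential operators $\mathcal{D}(P_n)$); on $\mathcal{D}_n$, $\delta_i(\partial^{[\alpha]})=\partial^{[\alpha-e_i]}$ (zero if $\alpha_i=0$), so $\delta_i^{p^s}$ maps $\mathcal{D}_n$ to itself; $\delta^{p^s}=(\delta_1^{p^s},\ldots,\delta_n^{p^s})$. $\mathrm{ID}(\delta^{p^s},\mathcal{D}_n)$ is the set of families $\{y^{[\alpha]}\}_{\alpha\in\mathbb{N}^n}\subseteq\mathcal{D}_n$ with $y^{[0]}=1$, $y^{[\alpha]}y^{[\beta]}=\binom{\alpha+\beta}{\beta}y^{[\alpha+\beta]}$ and $\prod_i(\delta_i^{p^s})^{\alpha_i}(y^{[\beta]})=y^{[\beta-\alpha]}$ for all $\alpha,\beta$ ($y^{[\gamma]}=0$ if $\gamma\notin\mathbb{N}^n$). The dual integration $\int_i^*:\mathcal{D}_n\to\mathcal{D}_n$ is the $K$-linear map $\partial^{[\alpha]}\mapsto\partial^{[\alpha+e_i]}$, and $\int_i^{*p^s}$ is its $p^s$-th power. $C_s^n=\{\alpha\in\mathbb{N}^n\mid\alpha_i<p^s\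 \forall i\}$. $\mathcal{M}_{n,s}$ is the set of matrices $u=(u_{ik})$, $i=1,\ldots,n$, $k\in\mathbb{N}$, with all $u_{ik}\in\bigoplus_{0\neq\alpha\in C_s^n}K\partial^{[\alpha]}$. *)

(* Defs.v *)
From mathcomp Require Import all_boot all_order all_algebra.
Set Implicit Arguments. Unset Strict Implicit. Unset Printing Implicit Defensive.
Import GRing.Theory.
Local Open Scope ring_scope.

Section DivPow.
Variables (K : fieldType) (n : nat).

Definition mi := {ffun 'I_n -> nat}.
Definition mi0 : mi := [ffun=> 0%N].
Definition miadd (a b : mi) : mi := [ffun j => (a j + b j)%N].
Definition misub (a b : mi) : mi := [ffun j => (a j - b j)%N].  (* truncated *)
Definition mile (a b : mi) : bool := [forall j, (a j <= b j)%N].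
Definition mie (i : 'I_n) (m : nat) : mi := [ffun j => if j == i then m else 0%N].
Definition mibin (a b : mi) : nat := \prod_(j < n) 'C(a j, b j).

(* Coefficient functions: f represents sum_alpha f(alpha) d^[alpha]. *)
Definition Dfun := mi -> K.
(* membership in D_n = (+)_alpha K d^[alpha]: finite support *)
Definition inD (f : Dfun) : Prop :=
  exists N : nat, forall a : mi, f a != 0 -> forall j, (a j < N)%N.

Definition dbasis (a : mi) : Dfun := fun b => (b == a)%:R.
Definition done : Dfun := dbasis mi0.
Definition dadd (f g : Dfun) : Dfun := fun a => f a + g a.
Definition dsub (f g : Dfun) : Dfun := fun a => f a - g a.
Definition dscale (c : K) (f : Dfun) : Dfun := fun a => c * f a.
(* product determined by d^[a] d^[b] = binom(a+b, b) d^[a+b] *)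
Definition dmul (f g : Dfun) : Dfun := fun a =>
  \sum_(b : {ffun 'I_n -> 'I_((\max_(j < n) a j)%N).+1}
          | [forall j, (b j <= a j)%N])
     (mibin a [ffun j => (b j : nat)])%:R
       * f [ffun j => (b j : nat)] * g [ffun j => (a j - b j)%N].
Definition dpow (f : Dfun) (m : nat) : Dfun := iter m (dmul f) done.
Definition ddivpow (f : Dfun) (m : nat) : Dfun := dscale (m`!)%:R^-1 (dpow f m).

(* dual integration  int_i^* : d^[a] |-> d^[a + e_i] *)
Definition dint (i : 'I_n) (f : Dfun) : Dfun := fun a =>
  if (0 < a i)%N then f (misub a (mie i 1)) else 0.
(* delta_i = -ad(x_i) on D_n : d^[a] |-> d^[a - e_i] (0 if a_i = 0) *)
Definition ddelta (i : 'I_n) (f : Dfun) : Dfun := fun a => f (miadd a (mie i 1)).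

Definition ddeltaP (q : nat) (a : mi) (f : Dfun) : Dfun :=
  foldr (fun i g => iter (a i) (iter q (ddelta i)) g) f (enum 'I_n).

Definition inID (p s : nat) (y : mi -> Dfun) : Prop :=
  [/\ forall a, inD (y a),
      y mi0 = done,
      forall a b, dmul (y a) (y b) = dscale (mibin (miadd a b) b)%:R (y (miadd a b))
    & forall a b, ddeltaP (p ^ s) a (y b) =
                  if mile a b then y (misub b a) else (fun _ => 0)].

Definition inMns (p s : nat) (u : 'I_n -> nat -> Dfun) : Prop :=
  forall i k, inD (u i k) /\
    forall a, u i k a != 0 -> a != mi0 /\ forall j, (a j < p ^ s)%N.

(* y_{u,i}^{[p^k]} together with prod_{l=0}^{k} (y^{[p^l]})^{p-1}/(p-1)! *)
Fixpoint yP (p s : nat) (u : 'I_n -> nat -> Dfun) (i : 'I_n) (k : nat)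
    : Dfun * Dfun :=
  match k with
  | 0 => let y0 := dadd (dbasis (mie i (p ^ s))) (u i 0%N) in
         (y0, ddivpow y0 p.-1)
  | k'.+1 => let P := (yP p s u i k').2 in
             let y := dadd (u i k) (iter (p ^ s) (dint i) P) in
             (y, dmul P (ddivpow y p.-1))
  end.
Definition ypk p s u i k : Dfun := (yP p s u i k).1.

Definition yj p s u (i : 'I_n) (j : nat) : Dfun :=
  \big[dmul/done]_(k < j.+1) ddivpow (ypk p s u i k) ((j %/ p ^ k) %% p).
Definition yu p s u (a : mi) : Dfun := \big[dmul/done]_(i < n) yj p s u i (a i).

Definition uz (p s : nat) (z : mi -> Dfun) : 'I_n -> nat -> Dfun := fun i k =>
  dsub (z (mie i (p ^ k))) (iter (p ^ s) (dint i) (z (mie i (p ^ k).-1))).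

End DivPow.

(* Main.v *)
Require Import Defs.
From HB Require Import structures.
From mathcomp Require Import all_boot all_order all_algebra.
From mathcomp Require Import boolp.
Import GRing.Theory.
Set Implicit Arguments. Unset Strict Implicit. Unset Printing Implicit Defensive.
Local Open Scope ring_scope.

(** Write [q = p ^ s]. In characteristic [p] the map [delta_i^q] is a derivation, the
    common kernel of these maps is the span of the [d^[a]] with all [a_j < q], and an element
    without constant term has zero p-th power, because every [delta_j] kills that power.
    By Lucas' theorem a divided power family [z_i^[j]] is the product over the base-p digits
    of [j] of divided powers of its members [z_i^[p^k]], and conversely any elements
    [y_k] with [y_k ^+ p = 0] generate such a family. The condition on [delta_i^q] then
    reduces to [delta_i^q (y_k) = y^[p^k - 1]], [delta_j^q (y_k) = 0] for [j != i]: this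
    determines [y_k] up to the common kernel, [int_i^q] of the right-hand side being a
    particular solution, and the free parameter is [u_ik]; it has no constant term
    since [z_i^[p^k]] is nilpotent. *)

(** * Divided powers and derivations in characteristic p *)

Section CharP.
Variables (K : fieldType) (p : nat).
Hypothesis pcharKp : p \in [pchar K].

Let p_pr : prime p := pcharf_prime pcharKp.
Let p_gt0 : (0 < p)%N := prime_gt0 p_pr.

Lemma natr_fact_neq0 m : (m < p)%N -> (m`!)%:R != 0 :> K.
Proof.
elim: m => [|m IHm] ltmp; first by rewrite oner_neq0.
rewrite factS natrM mulf_neq0 ?IHm ?(ltnW ltmp) //.
by rewrite -(dvdn_pcharf pcharKp) gtnNdvd.
Qed.

(** Coefficient form of (1+X)^(p+N) = (1+X^p)(1+X)^N: in Vandermonde's sum [p] divides all 'C(p, i)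
    with 0 < i < p. The conditional guards against truncated subtraction. *)
Lemma natr_bin_pcharD N m :
  ('C(p + N, m))%:R = ('C(N, m))%:R + (if (p <= m)%N then 'C(N, m - p) else 0%N)%:R :> K.
Proof.
rewrite -binomial.Vandermonde natr_sum big_ord_recl /= bin0 mul1n subn0; congr (_ + _).
case: leqP => [lepm|ltmp]; last first.
  rewrite big1 // => i _; apply/eqP; rewrite -(dvdn_pcharf pcharKp) dvdn_mulr //.
  by rewrite prime_dvd_bin //= /bump /= add1n (leq_ltn_trans (ltn_ord i)).
have lt_pm : (p.-1 < m)%N by rewrite prednK.
rewrite (bigD1 (Ordinal lt_pm)) //= /bump /= add1n prednK // binn mul1n.
rewrite big1 ?addr0 // => i; rewrite -val_eqE /= => neq_i.
apply/eqP; rewrite -(dvdn_pcharf pcharKp) /bump /= add1n.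
case: (ltngtP i.+1 p) => [lt_ip|gt_ip|eq_ip].
- by rewrite dvdn_mulr // prime_dvd_bin.
- by rewrite bin_small.
- by move: neq_i; rewrite -eq_ip eqxx.
Qed.

(** By [natr_bin_pcharD], raising [a] by one acts on the pair [a], [b] as Pascal's rule. *)
Lemma natr_bin_Lucas a b r t : (r < p)%N -> (t < p)%N ->
  ('C(a * p + r, b * p + t))%:R = ('C(a, b) * 'C(r, t))%:R :> K.
Proof.
move=> ltrp lttp; elim: a b => [|a IHa] [|b].
- by rewrite !mul0n bin0 mul1n.
- rewrite bin0n /= !mul0n add0n bin_small // mulSn -addnA.
  exact: leq_trans ltrp (leq_addr _ _).
- rewrite mulSn -addnA natr_bin_pcharD mul0n add0n leqNgt lttp addr0 -[t in LHS]add0n.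
  by rewrite -[X in (X + t)%N](mul0n p) IHa !bin0.
- rewrite !(mulSn, =^~ addnA) natr_bin_pcharD leq_addr addKn -natrD.
  by rewrite addnA -mulSn natrD !IHa -natrD -mulnDl -binS.
Qed.

(** * Products of divided powers over base-p digits *)

Section DividedPowers.
Variable A : comAlgType K.
Implicit Types (x w : A) (y Z : nat -> A) (D : A -> A).

(** For [m >= p] the factorial is zero in [K], and so is its inverse by convention; the digits used
    as exponents stay below [p]. *)
Definition divpow m x : A := (m`!)%:R^-1 *: x ^+ m.

Lemma divpow0 x : divpow 0 x = 1.
Proof. by rewrite /divpow invr1 scale1r. Qed.

Lemma divpow1 x : divpow 1 x = x.
Proof. by rewrite /divpow invr1 scale1r. Qed.

Lemma divpowM x r t : (r + t < p)%N ->
  divpow r x * divpow t x = ('C(r + t, t))%:R *: divpow (r + t) x.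
Proof.
move=> lt_p; rewrite /divpow -scalerAl -scalerAr !scalerA -exprD; congr (_ *: _).
have nzr : (r`!)%:R != 0 :> K by rewrite natr_fact_neq0 // (leq_ltn_trans _ lt_p) ?leq_addr.
have nzt : (t`!)%:R != 0 :> K by rewrite natr_fact_neq0 // (leq_ltn_trans _ lt_p) ?leq_addl.
have nzrt : ((r + t)`!)%:R != 0 :> K by rewrite natr_fact_neq0.
apply: (mulIf nzrt); rewrite mulfVK // -(bin_fact (leq_addl r t)) addnK !natrM.
rewrite mulrC -!mulrA [(t`!)%:R * _]mulrCA [X in _ * X]mulrA.
by rewrite [X in _ * (_ * X)]mulrC !mulrA mulfK // mulfK.
Qed.

Lemma divpowM_eq0 x r t : x ^+ p = 0 -> (p <= r + t)%N -> divpow r x * divpow t x = 0.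
Proof.
move=> xp0 le_p; rewrite /divpow -scalerAl -scalerAr -exprD -(subnK le_p) exprD xp0.
by rewrite mulr0 !scaler0.
Qed.

(* The divided power of exponent [j < p ^ N] built from the [y k = y^[p^k]] via the base-p digits of [j]. *)
Definition dpfam y N j : A := \prod_(k < N) divpow ((j %/ p ^ k) %% p) (y k).

(** Inductions peel off the lowest digit, as in Lucas' theorem; what remains is the same
    construction for the shifted sequence. *)
Lemma dpfam_rec y N j :
  dpfam y N.+1 j = divpow (j %% p) (y 0%N) * dpfam (y \o succn) N (j %/ p).
Proof.
rewrite /dpfam big_ord_recl /= expn0 divn1; congr (_ * _).
by apply: eq_bigr => k _; rewrite /bump /= add1n expnS divnMA.
Qed.

Lemma dpfamMD y N a r : (r < p)%N ->
  dpfam y N.+1 (a * p + r) = divpow r (y 0%N) * dpfam (y \o succn) N a.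
Proof. by move=> ltrp; rewrite dpfam_rec modnMDl modn_small // divnMDl // divn_small // addn0. Qed.

Lemma dpfam_ord0 y j : dpfam y 0 j = 1.
Proof. by rewrite /dpfam big_ord0. Qed.

Lemma dpfam0 y N : dpfam y N 0 = 1.
Proof. by rewrite /dpfam big1 // => k _; rewrite div0n mod0n divpow0. Qed.

Lemma dpfam_widen y N M j : (j < p ^ N)%N -> (N <= M)%N -> dpfam y M j = dpfam y N j.
Proof.
move=> ltj /subnKC <-; elim: (M - N)%N => [|m IHm]; first by rewrite addn0.
rewrite addnS /dpfam big_ord_recr /= -/(dpfam _ _ _) IHm divn_small.
  by rewrite mod0n divpow0 mulr1.
by rewrite (leq_trans ltj) // leq_pexp2l // leq_addr.
Qed.

(** Digits beyond the leading one are zero and contribute the factor 1, so each argument may choose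
    its own cutoff. *)
Lemma dpfam_indep y N M j : (j < p ^ N)%N -> (j < p ^ M)%N -> dpfam y M j = dpfam y N j.
Proof.
move=> ltN ltM; case: (leqP N M) => [leNM|/ltnW leMN]; first exact: dpfam_widen.
by rewrite (dpfam_widen _ ltM leMN).
Qed.

Lemma dpfam_pexp y N k : (k < N)%N -> dpfam y N (p ^ k) = y k.
Proof.
elim: N k y => [//|N IHN] [|k] y ltkN.
  by rewrite expn0 -[1%N]add0n -[X in (X + _)%N](mul0n p) dpfamMD ?prime_gt1 // dpfam0 divpow1 mulr1.
by rewrite expnSr -[X in dpfam _ _ X]addn0 dpfamMD // divpow0 mul1r IHN.
Qed.

Lemma predn_pexpS N : (p ^ N.+1).-1 = ((p ^ N).-1 * p + p.-1)%N.
Proof.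
have := expn_gt0 p N; rewrite p_gt0 /= expnSr; case: (p ^ N)%N => //= m _.
by rewrite mulSn -[in RHS]subn1 addnBA // subn1 addnC.
Qed.

(** All [N] digits of p^N - 1 equal p - 1. This identifies the product in the recursion for y^[p^N]
    with the member y^[p^N - 1]. *)
Lemma dpfam_predn y N : dpfam y N (p ^ N).-1 = \prod_(k < N) divpow p.-1 (y k).
Proof.
elim: N y => [|N IHN] y; first by rewrite !big_ord0 dpfam_ord0.
by rewrite predn_pexpS dpfamMD ?prednK // IHN big_ord_recl.
Qed.

Lemma dpfamM y N i j : (forall k, y k ^+ p = 0) -> (i + j < p ^ N)%N ->
  dpfam y N i * dpfam y N j = ('C(i + j, j))%:R *: dpfam y N (i + j).
Proof.
elim: N y i j => [|N IHN] y i j yp0.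
  by rewrite expn0 ltnS leqn0 addn_eq0 => /andP[/eqP-> /eqP->]; rewrite !dpfam_ord0 mul1r scale1r.
rewrite (divn_eq i p) (divn_eq j p); move: (ltn_pmod i p_gt0) (ltn_pmod j p_gt0).
move: (i %/ p)%N (j %/ p)%N (i %% p)%N (j %% p)%N => a b r t ltrp lttp.
rewrite addnACA -mulnDl expnSr => lt_ab.
have lt_ab' : (a + b < p ^ N)%N.
  by rewrite -(ltn_pmul2r p_gt0); apply: leq_ltn_trans lt_ab; rewrite leq_addr.
rewrite (dpfamMD _ _ _ ltrp) (dpfamMD _ _ _ lttp) mulrACA (IHN (y \o succn) _ _ (fun k => yp0 k.+1)) //.
(* Without a carry in the lowest digit, Lucas' theorem factors the binomial. With a carry both sides
   vanish: the left one since y_0^p = 0, the right one since the lowest digit [r + t - p] of the sum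
   is below [t]. *)
case: (ltnP (r + t) p) => [lt_rt|ge_rt].
  by rewrite dpfamMD // divpowM // natr_bin_Lucas // -scalerAl -scalerAr scalerA -natrM mulnC.
rewrite divpowM_eq0 // mul0r.
have -> : ((a + b) * p + (r + t) = (a + b).+1 * p + (r + t - p))%N.
  by rewrite mulSn [(p + _)%N]addnC -addnA subnKC.
have lt_c : (r + t - p < t)%N by rewrite ltn_subLR // ltn_add2r.
by rewrite natr_bin_Lucas ?(ltn_trans lt_c) // (bin_small lt_c) muln0 scale0r.
Qed.

Definition derivation D := [/\ linear D & forall f g, D (f * g) = D f * g + f * D g].

Lemma derivation1 D : derivation D -> D 1 = 0.
Proof.
by case=> _ /(_ 1 1); rewrite !mulr1 mul1r => /(congr1 (+%R^~ (- D 1))); rewrite addrK subrr.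
Qed.

Lemma derivationX D x m : derivation D -> D (x ^+ m.+1) = m.+1%:R *: (x ^+ m * D x).
Proof.
move=> dD; have [_ DM] := dD; elim: m => [|m IHm]; first by rewrite mul1r scale1r.
rewrite exprS DM IHm -scalerAr mulrA -exprS -[in RHS]natr1 scalerDl scale1r addrC.
by rewrite [D x * _]mulrC.
Qed.

Lemma derivationZ D c x : derivation D -> D (c *: x) = c *: D x.
Proof.
case=> linD _; have D0 : D 0 = 0 by have := linD (-1) 0 0; rewrite !scaler0 addr0 scaleN1r addNr.
by rewrite -[c *: x]addr0 linD D0 addr0.
Qed.

Lemma derivation_divpow D x m : derivation D -> (m.+1 < p)%N ->
  D (divpow m.+1 x) = divpow m x * D x.
Proof.
move=> dD ltmp; rewrite /divpow derivationZ // derivationX // scalerA -scalerAl.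
congr (_ *: _); rewrite factS natrM invfM mulrAC mulVf ?mul1r //.
by rewrite -(dvdn_pcharf pcharKp) gtnNdvd.
Qed.

(* The factor [w] makes the statement stable under dropping [y 0]: the shifted family
   satisfies the same hypothesis with [w * divpow p.-1 (y 0)]. *)
Lemma derivation_dpfam D y N j w : derivation D -> (forall k, y k ^+ p = 0) ->
  (forall k, D (y k) = w * \prod_(l < k) divpow p.-1 (y l)) -> (j < p ^ N)%N ->
  D (dpfam y N j) = if (0 < j)%N then w * dpfam y N j.-1 else 0.
Proof.
move=> dD; have [_ DM] := dD; elim: N y j w => [|N IHN] y j w yp0 Dy.
  by rewrite expn0 ltnS leqn0 => /eqP->; rewrite dpfam_ord0 derivation1.
rewrite (divn_eq j p); move: (ltn_pmod j p_gt0).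
move: (j %/ p)%N (j %% p)%N => {j}a r ltrp lt_a.
have {}lt_a : (a < p ^ N)%N.
  by rewrite -(ltn_pmul2r p_gt0) -expnSr; apply: leq_ltn_trans lt_a; rewrite leq_addr.
have IH := IHN (y \o succn) a (w * divpow p.-1 (y 0%N)) (fun k => yp0 k.+1).
rewrite dpfamMD // DM {}IH //; last first.
  by move=> k /=; rewrite Dy big_ord_recl mulrA; congr (_ * _); apply: eq_bigr.
(* If the lowest digit is 0, the predecessor borrows: its lowest digit is p - 1, and the enlarged
   factor in [IH] supplies the matching divided power. *)
case: r ltrp => [|r] ltrp.
  rewrite divpow0 mul1r derivation1 // mul0r add0r addn0.
  case: a lt_a => [|a] lt_a; first by rewrite mul0n.
  rewrite /= -mulrA -(dpfamMD _ _ _ (_ : p.-1 < p)%N) ?prednK //.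
  by rewrite mulSn addn_gt0 p_gt0 /=; congr (w * dpfam y _ _); rewrite -!subn1 addnBA // addnC.
rewrite derivation_divpow // Dy big_ord0 mulr1 addnS /= dpfamMD ?(ltnW ltrp) //.
(* For a positive lowest digit the term that differentiates the higher digits contains y_0 to a
   power at least [p]. *)
suff kill : divpow r.+1 (y 0%N) * divpow p.-1 (y 0%N) = 0.
  case: ifP => _; rewrite ?mulr0 ?addr0; last by rewrite mulrAC mulrC.
  by rewrite -[w * _ * _]mulrA mulrCA [divpow r.+1 _ * _]mulrA kill mul0r mulr0 addr0 mulrAC mulrC.
by rewrite divpowM_eq0 // addSn -addnS prednK // leq_addl.
Qed.

(** * Sequences obeying the divided power law *)

Definition divpow_law Z := Z 0%N = 1 /\ forall i j, Z i * Z j = ('C(i + j, j))%:R *: Z (i + j)%N.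

Lemma divpow_lawX Z r : divpow_law Z -> Z 1%N ^+ r = (r`!)%:R *: Z r.
Proof.
case=> Z0 ZM; elim: r => [|r IHr]; first by rewrite Z0 scale1r.
by rewrite exprSr IHr -scalerAl ZM addn1 bin1 scalerA -natrM mulnC -factS.
Qed.

(** Lucas' theorem with zero lowest digits: 'C(i p, j p) and 'C(i, j) agree in [K]. *)
Lemma divpow_law_shift Z : divpow_law Z -> divpow_law (fun j => Z (j * p)%N).
Proof.
case=> Z0 ZM; split=> [|i j]; first by rewrite mul0n.
have := natr_bin_Lucas (i + j) j p_gt0 p_gt0; rewrite !addn0 bin0 muln1 => <-.
by rewrite ZM mulnDl.
Qed.

Lemma divpow_law_pexp Z k : divpow_law Z -> divpow_law (fun j => Z (j * p ^ k)%N).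
Proof.
elim: k Z => [|k IHk] Z lawZ.
  by case: lawZ => Z0 ZM; split=> [|i j]; rewrite ?mul0n ?expn0 ?muln1.
have [Z0 ZM] := IHk _ (divpow_law_shift lawZ).
by split=> [|i j]; rewrite expnSr !mulnA.
Qed.

(** Along the multiples of p^k the law gives p! Z(p^(k+1)) for this power, and p! = 0 in [K]. *)
Lemma divpow_law_nilp Z k : divpow_law Z -> Z (p ^ k)%N ^+ p = 0.
Proof.
move/(divpow_law_pexp k)/(divpow_lawX p); rewrite mul1n => ->.
have /eqP-> : (p`!)%:R == 0 :> K by rewrite -(dvdn_pcharf pcharKp) dvdn_fact ?p_gt0 /=.
by rewrite scale0r.
Qed.

(** Since 'C(a p + r, r) = 1 in [K], Z(a p + r) = Z(a p) Z(r) with Z(r) = Z(1)^r / r!; the factor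
    Z(a p) is handled by induction on the shifted sequence. *)
Lemma divpow_law_dpfam Z N j : divpow_law Z -> (j < p ^ N)%N ->
  dpfam (fun k => Z (p ^ k)%N) N j = Z j.
Proof.
elim: N j Z => [|N IHN] j Z lawZ.
  by rewrite expn0 ltnS leqn0 => /eqP->; rewrite dpfam_ord0; case: lawZ.
rewrite (divn_eq j p); move: (ltn_pmod j p_gt0).
move: (j %/ p)%N (j %% p)%N => {j}a r ltrp lt_a.
have {}lt_a : (a < p ^ N)%N.
  by rewrite -(ltn_pmul2r p_gt0) -expnSr; apply: leq_ltn_trans lt_a; rewrite leq_addr.
rewrite dpfamMD // expn0 [X in _ * X](_ : _ = Z (a * p)%N); last first.
  rewrite -(IHN a _ (divpow_law_shift lawZ) lt_a) /dpfam.
  by apply: eq_bigr => k _ /=; rewrite expnSr.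
rewrite /divpow (divpow_lawX _ lawZ) scalerA mulVf ?natr_fact_neq0 // scale1r mulrC.
have := natr_bin_Lucas a 0 ltrp ltrp; rewrite mul0n add0n bin0 binn => binE.
by case: lawZ => _ ->; rewrite binE scale1r.
Qed.

End DividedPowers.

(** * Iterates of a derivation *)

Section IteratedDerivation.
Variable A : comAlgType K.
Variable D : A -> A.
Hypothesis dD : derivation D.

Lemma derivation_linear_iter m : linear (iter m D).
Proof.
have [linD _] := dD; elim: m => [|m IHm] c x z //=.
by rewrite IHm linD.
Qed.

Lemma derivation_iterM m f g :
  iter m D (f * g) = \sum_(k < m.+1) ('C(m, k))%:R *: (iter k D f * iter (m - k) D g).
Proof.
have [linD DM] := dD.
have DD x y : D (x + y) = D x + D y by have := linD 1 x y; rewrite !scale1r.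
have D0 : D 0 = 0 by have := derivationZ 0 0 dD; rewrite !scale0r.
elim: m => [|m IHm]; first by rewrite big_ord1 scale1r.
rewrite iterS IHm (big_morph D DD D0).
under eq_bigr => k _ do rewrite derivationZ // DM scalerDr.
rewrite big_split /= [RHS]big_ord_recl /= bin0 scale1r.
rewrite [X in _ + X = _]big_ord_recl /= bin0 scale1r subn0 addrCA; congr (_ + _).
under [RHS]eq_bigr => k _ do rewrite /bump /= add1n add0n binS natrD scalerDl subSS.
rewrite big_split /= addrC [X in _ = X + _]big_ord_recr /= bin_small // scale0r addr0.
congr (_ + _); apply: eq_bigr => k _; rewrite /bump /= add1n add0n /=.
by rewrite -[D (iter (m - _) D g)]iterS subnSK.
Qed.

(** In the iterated Leibniz formula the inner binomials 'C(p, k) vanish in [K], leaving the two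
    extreme terms. *)
Lemma derivation_iter_pchar : derivation (iter p D).
Proof.
split; first exact: derivation_linear_iter.
move=> f g; rewrite derivation_iterM big_ord_recr /= subnn binn scale1r.
rewrite -(big_mkord xpredT (fun k => ('C(p, k))%:R *: (iter k D f * iter (p - k) D g))).
rewrite big_ltn //= bin0 subn0 scale1r big_nat_cond big1 ?addr0 1?addrC // => k.
rewrite andbT => lt_k; have := prime_dvd_bin p_pr lt_k; rewrite (dvdn_pcharf pcharKp) => /eqP->.
by rewrite scale0r.
Qed.

End IteratedDerivation.

Lemma derivation_iter_pexp (A : comAlgType K) (D : A -> A) s :
  derivation D -> derivation (iter (p ^ s) D).
Proof.
elim: s D => [//|s IHs] D dD; have [linD DM] := IHs _ (derivation_iter_pchar dD).
have itE f : iter (p ^ s.+1) D f = iter (p ^ s) (iter p D) f.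
  by rewrite expnSr; elim: (p ^ s)%N => //= m <-; rewrite mulSn iterD.
by split=> [c f g|f g]; rewrite !itE ?linD ?DM.
Qed.

End CharP.

(** * The divided power algebra *)

Section MultiIndex.
Variable n : nat.
Implicit Types a b : mi n.

Lemma mi0E j : mi0 n j = 0%N. Proof. by rewrite ffunE. Qed.
Lemma miaddE a b j : miadd a b j = (a j + b j)%N. Proof. by rewrite ffunE. Qed.
Lemma misubE a b j : misub a b j = (a j - b j)%N. Proof. by rewrite ffunE. Qed.
Lemma mieE i m j : mie i m j = if j == i :> 'I_n then m else 0%N. Proof. by rewrite ffunE. Qed.

Definition miE := (mi0E, miaddE, misubE, mieE).

(** Induction on the total degree. As [ddelta i f] at [a] is [f] at [miadd a (mie i 1)], it reduces
    identities of coefficient functions to the constant coefficient and to their derivatives. *)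
Lemma mi_ind (P : mi n -> Prop) :
  P (mi0 n) -> (forall a i, P a -> P (miadd a (mie i 1))) -> forall a, P a.
Proof.
move=> P0 PS a; have [m] := ubnP (\sum_j a j); elim: m a => // m IHm a lt_am.
have [/forallP a0|/forallPn[i]] := boolP [forall j, a j == 0%N].
  by rewrite (_ : a = mi0 n) //; apply/ffunP => j; rewrite miE; apply/eqP.
rewrite -lt0n => ai_gt0.
have -> : a = miadd (misub a (mie i 1)) (mie i 1).
  by apply/ffunP => j; rewrite !miE subnK //; case: eqP => // ->.
apply/PS/IHm; rewrite -ltnS (leq_trans _ lt_am) // ltnS (bigD1 i) //= [ltnRHS](bigD1 i) //=.
rewrite !miE eqxx -addSn subn1 prednK // leq_add2l leq_sum // => j /negPf neq_ji.
by rewrite !miE neq_ji subn0.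
Qed.

Lemma mibin_eq0 a b j : (a j < b j)%N -> mibin a b = 0%N.
Proof. by move=> lt_ab; rewrite /mibin (bigD1 j) //= bin_small. Qed.

Lemma mibin_mie (i : 'I_n) r t : mibin (miadd (mie i r) (mie i t)) (mie i t) = 'C(r + t, t).
Proof.
rewrite /mibin (bigD1 i) //= !miE eqxx big1 ?muln1 // => j /negPf neq_ji.
by rewrite !miE neq_ji.
Qed.

(** Pascal's rule in coordinate [i]. The guard is essential as [misub] truncates: at [b i = 0] the
    second term would repeat the first. *)
Lemma mibin_addS a b i : mibin (miadd a (mie i 1)) b =
  (mibin a b + if 0 < b i then mibin a (misub b (mie i 1)) else 0)%N.
Proof.
rewrite /mibin (bigD1 i) //= [X in (_ = X + _)%N](bigD1 i) //= miE mieE eqxx addn1.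
rewrite (eq_bigr (fun j => 'C(a j, b j))); last first.
  by move=> j /negPf neq_ji; rewrite miE mieE neq_ji addn0.
case eq_bi: (b i) => [|m] /=; first by rewrite !bin0 addn0.
rewrite binS mulnDl; congr (_ + _)%N; rewrite [RHS](bigD1 i) //= miE mieE eqxx eq_bi subn1.
congr (_ * _)%N; apply: eq_bigr => j /negPf neq_ji.
by rewrite miE mieE neq_ji subn0.
Qed.

Definition mi_of N (b : {ffun 'I_n -> 'I_N}) : mi n := [ffun j => (b j : nat)].

End MultiIndex.

(** * The divided power product: Leibniz rule and ring axioms *)

Section Product.
Variables (K : fieldType) (n : nat).
Implicit Types (f g h : Dfun K n) (a b : mi n).

(** In [dmul] the summation box depends on [a]. A common box allows comparing coefficients at
    different indices; the added terms have a zero binomial. *)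
Lemma dmulE N f g a : (forall j, a j <= N)%N -> dmul f g a =
  \sum_(b : {ffun 'I_n -> 'I_N.+1}) (mibin a (mi_of b))%:R * f (mi_of b) * g (misub a (mi_of b)).
Proof.
move=> le_aN; set M := (\max_(j < n) a j)%N.
have le_aM j : (a j <= M)%N by rewrite /M (leq_bigmax j).
rewrite [RHS](bigID (fun b : {ffun 'I_n -> 'I_N.+1} => [forall j, b j <= a j]%N)) /=.
rewrite [X in _ + X]big1 ?addr0; last first.
  move=> b /forallPn[j]; rewrite -ltnNge => lt_ab.
  by rewrite (mibin_eq0 (j := j)) ?mul0r // ffunE.
pose up (b : {ffun 'I_n -> 'I_M.+1}) : {ffun 'I_n -> 'I_N.+1} := [ffun j => inord (b j)].
pose dn (b : {ffun 'I_n -> 'I_N.+1}) : {ffun 'I_n -> 'I_M.+1} := [ffun j => inord (b j)].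
have le_MN : (M <= N)%N by apply/bigmax_leqP.
have upE (b : {ffun 'I_n -> 'I_M.+1}) j : up b j = b j :> nat.
  by rewrite ffunE inordK // ltnS (leq_trans _ le_MN) // -ltnS.
rewrite (reindex_onto up dn) /=; last first.
  move=> b /forallP le_ba; apply/ffunP => j; apply: val_inj; rewrite /= upE ffunE inordK //.
  by rewrite ltnS (leq_trans (le_ba j)).
have upK (b : {ffun 'I_n -> 'I_M.+1}) : dn (up b) = b.
  by apply/ffunP => j; apply: val_inj; rewrite /= ffunE upE inordK.
have upmi (b : {ffun 'I_n -> 'I_M.+1}) : mi_of (up b) = mi_of b by apply/ffunP => j; rewrite ffunE upE ffunE.
rewrite /dmul -/M; apply: eq_big => b.
  by rewrite upK eqxx andbT; apply: eq_forallb => j; rewrite upE.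
move=> _; rewrite upmi; congr (_ * g _).
by apply/ffunP => j; rewrite !ffunE.
Qed.

Lemma dmul_mi0 f g : dmul f g (mi0 n) = f (mi0 n) * g (mi0 n).
Proof.
rewrite (@dmulE 0) => [|j]; last by rewrite miE.
rewrite (big_pred1 [ffun=> ord0]) => [|b]; last first.
  by apply/esym/eqP/ffunP => j; rewrite ffunE [b j]ord1.
have -> : mi_of [ffun=> ord0 : 'I_1] = mi0 n by apply/ffunP => j; rewrite !ffunE.
have -> : misub (mi0 n) (mi0 n) = mi0 n by apply/ffunP => j; rewrite !miE.
by rewrite /mibin big1 ?mul1r // => j _; rewrite miE bin0.
Qed.

Lemma ddelta_dmul i f g :
  ddelta i (dmul f g) = dadd (dmul (ddelta i f) g) (dmul f (ddelta i g)).
Proof.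
apply/funext => a; set N := (\max_(j < n) a j).+1%N.
have lt_aN j : (a j < N)%N by rewrite ltnS (leq_bigmax j).
have le_aN j : (a j <= N)%N by apply: ltnW.
have le_aiN j : (miadd a (mie i 1) j <= N)%N.
  by rewrite !miE; case: eqP => _; rewrite ?addn0 ?addn1.
rewrite /dadd {1}/ddelta (dmulE _ _ le_aiN) !(dmulE _ _ le_aN).
(* Pascal's rule splits the sum: the unshifted binomials give the term with [ddelta i g], the
   shifted ones that with [ddelta i f] after moving [b] by one in coordinate [i]. *)
under eq_bigr => b _ do rewrite mibin_addS natrD !mulrDl.
rewrite big_split /= addrC; congr (_ + _); last first.
  apply: eq_bigr => b _.
  have [/forallP le_ba|/forallPn[j]] := boolP [forall j, mi_of b j <= a j]%N; last first.
    by rewrite -ltnNge => lt_ab; rewrite (mibin_eq0 lt_ab) !mul0r.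
  congr (_ * _); rewrite /ddelta; congr (g _); apply/ffunP => j; rewrite !miE.
  by rewrite addnBAC // le_ba.
(* The cyclic shift wraps around only at index [N], where both summands vanish as [a i < N]. *)
pose h (b : {ffun 'I_n -> 'I_N.+1}) : {ffun 'I_n -> 'I_N.+1} :=
  [ffun j => if j == i then ordS (b j) else b j].
pose h' (b : {ffun 'I_n -> 'I_N.+1}) : {ffun 'I_n -> 'I_N.+1} :=
  [ffun j => if j == i then ord_pred (b j) else b j].
have h_bij : bijective h.
  exists h' => b; apply/ffunP => j; rewrite !ffunE; case: eqP => // _.
    exact: ordSK.
  exact: ord_predK.
rewrite (reindex h) /=; last exact: onW_bij.
apply: eq_bigr => b _; have [lt_bN|] := ltnP (b i) N.
  have hb : mi_of (h b) = miadd (mi_of b) (mie i 1).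
    apply/ffunP => j; rewrite !ffunE; case: eqP => [->|_]; rewrite ?addn0 //=.
    by rewrite modn_small // addn1.
  rewrite hb !miE eqxx addn1 /= /ddelta; congr (_%:R * _ * g _).
    congr mibin; apply/ffunP => j; rewrite !miE; exact: addnK.
  apply/ffunP => j; rewrite !miE; exact: subnDr.
move=> le_Nb; have eq_bN : b i = N :> nat by apply/eqP; rewrite eqn_leq le_Nb -ltnS ltn_ord.
have -> : mi_of (h b) i = 0%N by rewrite !ffunE eqxx /= eq_bN modnn.
by rewrite /= (mibin_eq0 (j := i)) ?mul0r // ffunE eq_bN.
Qed.

Lemma dmulDl f g h : dmul (dadd f g) h = dadd (dmul f h) (dmul g h).
Proof.
apply/funext => a; rewrite /dadd /dmul -big_split /=.
by apply: eq_bigr => b _; rewrite mulrDr mulrDl.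
Qed.

Lemma dmulZl c f g : dmul (dscale c f) g = dscale c (dmul f g).
Proof.
apply/funext => a; rewrite /dscale /dmul big_distrr /=.
by apply: eq_bigr => b _; rewrite !mulrA [_ * c]mulrC.
Qed.

(* A function is determined by its value at [mi0] and its images under the [ddelta i]: hence
   commutativity and associativity follow from the Leibniz rule by induction on the index. *)
Lemma dmulC f g : dmul f g = dmul g f.
Proof.
apply/funext => a; elim/mi_ind: a f g => [|a i IHa] f g; first by rewrite !dmul_mi0 mulrC.
rewrite -[LHS]/(ddelta i (dmul f g) a) -[RHS]/(ddelta i (dmul g f) a) !ddelta_dmul.
by rewrite /dadd addrC; congr (_ + _).
Qed.

Lemma dmulDr f g h : dmul f (dadd g h) = dadd (dmul f g) (dmul f h).
Proof. by rewrite dmulC dmulDl !(dmulC f). Qed.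

Lemma dmulA f g h : dmul f (dmul g h) = dmul (dmul f g) h.
Proof.
apply/funext => a; elim/mi_ind: a f g h => [|a i IHa] f g h; first by rewrite !dmul_mi0 mulrA.
rewrite -[LHS]/(ddelta i (dmul f (dmul g h)) a) -[RHS]/(ddelta i (dmul (dmul f g) h) a).
by rewrite !ddelta_dmul dmulDr dmulDl /dadd !IHa addrA.
Qed.

Lemma ddelta_done i : ddelta i (@done K n) = fun=> 0.
Proof.
apply/funext => a; rewrite /ddelta /done /dbasis; case: eqP => // /ffunP/(_ i).
by rewrite !miE eqxx addn1.
Qed.

Lemma dmul1 f : dmul (@done K n) f = f.
Proof.
apply/funext => a; elim/mi_ind: a f => [|a i IHa] f.
  by rewrite dmul_mi0 /done /dbasis eqxx mul1r.
rewrite -[LHS]/(ddelta i (dmul _ f) a) ddelta_dmul /dadd IHa ddelta_done.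
have -> : (fun=> 0) = dscale 0 (@done K n) by apply/funext => b; rewrite /dscale mul0r.
by rewrite dmulZl /dscale mul0r add0r.
Qed.

End Product.

(* An alias of [Dfun] carrying the divided power product, without the finite support condition. *)
Definition dser (K : fieldType) (n : nat) : Type := mi n -> K.

Section Algebra.
Variables (K : fieldType) (n : nat).
Local Notation A := (dser K n).
Implicit Types f g : A.

HB.instance Definition _ := gen_eqMixin A.
HB.instance Definition _ := gen_choiceMixin A.

Let dopp f : A := fun a => - f a.
Let daddA : associative (@dadd K n).
Proof. by move=> f g h; apply/funext => a; rewrite /dadd addrA. Qed.
Let daddC : commutative (@dadd K n).
Proof. by move=> f g; apply/funext => a; rewrite /dadd addrC. Qed.
Let dadd0 : left_id (fun=> 0) (@dadd K n).
Proof. by move=> f; apply/funext => a; rewrite /dadd add0r. Qed.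
Let daddN : left_inverse (fun=> 0) dopp (@dadd K n).
Proof. by move=> f; apply/funext => a; rewrite /dadd /dopp addNr. Qed.

HB.instance Definition _ := GRing.isZmodule.Build A daddA daddC dadd0 daddN.

Let done_neq0 : (@done K n : A) != 0.
Proof.
apply/eqP => /(congr1 (fun f : A => f (mi0 n))) /eqP.
by rewrite /done /dbasis eqxx oner_eq0.
Qed.

HB.instance Definition _ := GRing.Zmodule_isComNzRing.Build A
  (@dmulA K n) (@dmulC K n) (@dmul1 K n) (@dmulDl K n) done_neq0.

Let dscaleA c d f : dscale c (dscale d f) = dscale (c * d) f.
Proof. by apply/funext => a; rewrite /dscale mulrA. Qed.
Let dscale1 : left_id 1 (@dscale K n).
Proof. by move=> f; apply/funext => a; rewrite /dscale mul1r. Qed.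
Let dscaleDr : right_distributive (@dscale K n) (@dadd K n).
Proof. by move=> c f g; apply/funext => a; rewrite /dscale /dadd mulrDr. Qed.
Let dscaleDl f : {morph (@dscale K n)^~ f : c d / c + d >-> dadd c d}.
Proof. by move=> c d; apply/funext => a; rewrite /dscale /dadd mulrDl. Qed.

HB.instance Definition _ := GRing.Zmodule_isLmodule.Build K A dscaleA dscale1 dscaleDr dscaleDl.

Let dscaleAl c f g : c *: (f * g) = (c *: f) * g.
Proof. by rewrite -[RHS]/(dmul (dscale c f) g) dmulZl. Qed.

HB.instance Definition _ := GRing.Lmodule_isLalgebra.Build K A dscaleAl.
HB.instance Definition _ := GRing.Lalgebra_isComAlgebra.Build K A.

End Algebra.

(** * Closure properties of the kernel of a derivation *)

Section Kernel.
Variables (K : fieldType) (A : comAlgType K) (D : A -> A).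
Hypothesis dD : derivation D.

Lemma derivation_ker_prod I (r : seq I) (P : pred I) (F : I -> A) :
  (forall i, P i -> D (F i) = 0) -> D (\prod_(i <- r | P i) F i) = 0.
Proof.
have [_ DM] := dD => DF; apply: (big_ind (fun x => D x = 0)) => [|x z Dx Dz|//].
  exact: derivation1.
by rewrite DM Dx Dz mul0r mulr0 addr0.
Qed.

Lemma derivation_ker_divpow m x : D x = 0 -> D (divpow m x) = 0.
Proof.
move=> Dx; rewrite derivationZ //; case: m => [|m]; first by rewrite derivation1 // scaler0.
by rewrite derivationX // Dx mulr0 !scaler0.
Qed.

End Kernel.

(** * Shifts, dual integration and finite support *)

Section Operators.
Variables (K : fieldType) (n : nat).
Local Notation A := (dser K n).
Implicit Types (f g : A) (a b c : mi n).

Lemma ddelta_derivation i : derivation (ddelta i : A -> A).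
Proof. by split=> // f g; apply: ddelta_dmul. Qed.

Lemma iter_ddeltaE m i f a : iter m (ddelta i) f a = f (miadd a (mie i m)).
Proof.
elim: m a => [|m IHm] a /=; first by congr (f _); apply/ffunP => j; rewrite !miE if_same addn0.
rewrite /ddelta IHm; congr (f _); apply/ffunP => j; rewrite !miE.
by case: eqP; rewrite ?addn0 // addn1 addSnnS.
Qed.

Lemma iter_dintE m i f a :
  iter m (dint i) f a = if (m <= a i)%N then f (misub a (mie i m)) else 0.
Proof.
elim: m a => [|m IHm] a /=; first by congr (f _); apply/ffunP => j; rewrite !miE if_same subn0.
rewrite /dint IHm !miE eqxx; case: (a i) (erefl (a i)) => [//|k] eq_ai.
rewrite /= subn1 ltnS; case: leqP => // _; congr (f _); apply/ffunP => j; rewrite !miE.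
by case: eqP; rewrite ?subn0 // -subnDA add1n.
Qed.

Lemma ddeltaPE q a f c : ddeltaP q a f c = f [ffun j => (c j + a j * q)%N].
Proof.
rewrite /ddeltaP; set l := enum 'I_n.
(* Restricting the shift to the coordinates listed in [l] allows induction on [l]; its uniqueness
   ensures that each coordinate is shifted once. *)
have -> : [ffun j => (c j + a j * q)%N] =
          [ffun j => (c j + (if j \in l then a j * q else 0))%N].
  by apply/ffunP => j; rewrite !ffunE mem_enum.
elim: l (enum_uniq 'I_n : uniq l) c => [_|i l IHl /= /andP[/negPf il ul]] c /=.
  by congr (f _); apply/ffunP => j; rewrite ffunE addn0.
rewrite -iterM iter_ddeltaE IHl //; congr (f _); apply/ffunP => j; rewrite !ffunE in_cons.
by case: (j =P i) => [->|_]; rewrite ?il ?addn0.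
Qed.

Lemma dser_mi0M f g : (f * g) (mi0 n) = f (mi0 n) * g (mi0 n).
Proof. exact: dmul_mi0. Qed.

Lemma dser_mi0X f m : (f ^+ m) (mi0 n) = f (mi0 n) ^+ m.
Proof.
elim: m => [|m IHm]; last by rewrite !exprS dser_mi0M IHm.
by rewrite !expr0 -[LHS]/((mi0 n == mi0 n)%:R) eqxx.
Qed.

Lemma dpowE f m : dpow f m = f ^+ m.
Proof. by elim: m => [//|m IHm]; rewrite exprS -IHm. Qed.

Lemma ddivpowE f m : ddivpow f m = divpow m f.
Proof. by rewrite /ddivpow dpowE. Qed.

Lemma iter_ddelta_dintK q i f : iter q (ddelta i) (iter q (dint i) f) = f.
Proof.
apply/funext => a; rewrite iter_ddeltaE iter_dintE !miE eqxx leq_addl.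
by congr (f _); apply/ffunP => j; rewrite !miE addnK.
Qed.

Lemma iter_ddelta_dintC q i j f : j != i ->
  iter q (ddelta j) (iter q (dint i) f) = iter q (dint i) (iter q (ddelta j) f).
Proof.
move=> /negPf neq_ji; apply/funext => a; rewrite iter_ddeltaE !iter_dintE iter_ddeltaE.
rewrite !miE eq_sym neq_ji addn0; case: leqP => // le_q; congr (f _).
apply/ffunP => k; rewrite !miE; case: (k =P i) => [->|_]; last by rewrite !subn0.
by rewrite eq_sym neq_ji !addn0.
Qed.

Lemma iter_dint0 q i : iter q (dint i : A -> A) 0 = 0.
Proof. by apply/funext => a; rewrite iter_dintE if_same. Qed.

Lemma iter_dint_done q i : iter q (dint i : A -> A) 1 = dbasis K (mie i q).
Proof.
apply/funext => a; rewrite iter_dintE -[GRing.one A]/(@done K n) /done /dbasis.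
case: leqP => [le_qa|lt_aq]; last first.
  by case: eqP lt_aq => // ->; rewrite miE eqxx ltnn.
congr (_ %:R); congr nat_of_bool; apply/eqP/eqP => [/ffunP eq_a|->]; last first.
  by apply/ffunP => j; rewrite !miE subnn.
apply/ffunP => j; have := eq_a j; rewrite !miE; case: eqP => [->|_]; last by rewrite subn0.
by move/eqP; rewrite subn_eq0 => le_aq; apply/eqP; rewrite eqn_leq le_aq.
Qed.

Lemma inD1 : inD (GRing.one A).
Proof.
exists 1%N => a; rewrite -[GRing.one A]/(@done K n) /done /dbasis.
by case: (a =P mi0 n) => [-> _ j|_]; rewrite ?miE // eqxx.
Qed.

Lemma inD_add f g : inD f -> inD g -> inD (f + g).
Proof.
move=> [N fN] [M gM]; exists (N + M)%N => a; rewrite -[(f + g) a]/(f a + g a) => nz j.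
have [f0|/fN/(_ j) lt_a] := eqVneq (f a) 0; last exact: ltn_addr.
by apply/ltn_addl/gM; move: nz; rewrite f0 add0r.
Qed.

Lemma inD_mul f g : inD f -> inD g -> inD (f * g).
Proof.
move=> [N fN] [M gM]; exists (N + M)%N => a; rewrite -[(f * g) a]/(dmul f g a) => nz j.
rewrite ltnNge; apply: contraNN nz => le_a; rewrite /dmul big1 // => b /forallP le_ba.
have [le_Nb|lt_bN] := leqP N (b j).
  have /eqP-> : f [ffun j => (b j : nat)] == 0.
    by apply: contraTT le_Nb => /fN/(_ j); rewrite ffunE -ltnNge.
  by rewrite mulr0 mul0r.
have /eqP-> : g [ffun j => (a j - b j)%N] == 0; last by rewrite mulr0.
apply: contraTT le_a => /gM/(_ j); rewrite ffunE -ltnNge ltn_subLR // => lt_a.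
by rewrite (ltn_trans lt_a) // ltn_add2r.
Qed.

Lemma inD_scale (k : K) f : inD f -> inD (k *: f).
Proof.
move=> [N fN]; exists N => a; rewrite -[(k *: f) a]/(k * f a) => nz.
by apply: fN; apply: contraNneq nz => ->; rewrite mulr0.
Qed.

Lemma inD_prod I (r : seq I) (F : I -> A) :
  (forall i, inD (F i)) -> inD (\prod_(i <- r) F i).
Proof. by move=> DF; apply: (big_ind (@inD K n)); [exact: inD1 | exact: inD_mul |]. Qed.

Lemma inD_divpow m f : inD f -> inD (divpow m f).
Proof.
move=> Df; apply: inD_scale; elim: m => [|m IHm]; first exact: inD1.
by rewrite exprS; apply: inD_mul.
Qed.

Lemma inD_iter_dint q i f : inD f -> inD (iter q (dint i) f).
Proof.
move=> [N fN]; exists (N + q)%N => a; rewrite iter_dintE; case: leqP => [le_qa nz j|]; last by rewrite eqxx.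
have := fN _ nz j; rewrite !miE; case: eqP => [->|_]; first by rewrite ltn_subLR // addnC.
by rewrite subn0 => lt_a; apply: ltn_addr.
Qed.

Lemma dser_nilp p f : p \in [pchar K] -> f (mi0 n) = 0 -> f ^+ p = 0.
Proof.
move=> pcharKp f0; have p_gt0 := prime_gt0 (pcharf_prime pcharKp).
have dp i : ddelta i (f ^+ p) = 0 :> A.
  rewrite -(prednK p_gt0) (derivationX _ _ (ddelta_derivation i)) prednK //.
  by rewrite (pcharf0 pcharKp) scale0r.
apply/funext => a; elim/mi_ind: a => [|a i _]; first by rewrite dser_mi0X f0 expr0n eqn0Ngt p_gt0.
by rewrite -[LHS]/(ddelta i (f ^+ p) a) dp.
Qed.

(** If [q <= a i], the coefficient of [f] at [a] reappears in the iterated derivative at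
    [misub a (mie i q)]. *)
Lemma ddelta_supp q i f : iter q (ddelta i) f = 0 :> A ->
  forall a, f a != 0 -> (a i < q)%N.
Proof.
move=> df a; rewrite ltnNge; apply: contraNN => le_q.
have := congr1 (fun g : A => g (misub a (mie i q))) df; rewrite iter_ddeltaE.
rewrite (_ : miadd _ _ = a) => [->//|]; apply/ffunP => j; rewrite !miE subnK //.
by case: eqP => [->|].
Qed.

End Operators.

(** * Families of divided powers for the iterated derivations *)

Section Family.
Variables (K : fieldType) (p n s : nat).
Hypothesis pcharKp : p \in [pchar K].
Local Notation A := (dser K n).
Local Notation q := (p ^ s)%N.

Let p_pr : prime p := pcharf_prime pcharKp.
Let p_gt0 : (0 < p)%N := prime_gt0 p_pr.
Let q_gt0 : (0 < q)%N. Proof. by rewrite expn_gt0 p_gt0. Qed.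

Let D i : A -> A := iter q (ddelta i).

Let dD i : derivation (D i).
Proof. exact: (derivation_iter_pexp pcharKp s (ddelta_derivation K i)). Qed.

(** * From matrices to families *)

Section Forward.
Variable u : 'I_n -> nat -> Dfun K n.
Local Notation y i := (ypk p s u i : nat -> A).
Local Notation P i k := (\prod_(l < k) divpow p.-1 (y i l)).

Lemma yP_snd i k : (yP p s u i k).2 = P i k.+1.
Proof.
elim: k => [|k IHk]; first by rewrite big_ord1 -ddivpowE.
by rewrite big_ord_recr /= -IHk -ddivpowE.
Qed.

(** The separate clause of [yP] at 0 is the case of the empty product, because the q-fold integral
    of 1 is d^[q e_i]. *)
Lemma ypkE i k : ypk p s u i k = (u i k : A) + iter q (dint i) (P i k).
Proof.
case: k => [|k]; last by rewrite -yP_snd.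
by rewrite big_ord0 iter_dint_done addrC.
Qed.

Lemma yjE i N j : (j < p ^ N)%N -> yj p s u i j = dpfam p (y i) N j.
Proof.
move=> ltj; rewrite -(dpfam_indep pcharKp _ ltj (_ : j < p ^ j.+1)%N); last first.
  by rewrite (leq_trans (ltn_expl j (prime_gt1 p_pr))) // leq_pexp2l.
by rewrite /yj; apply: eq_bigr => k _; rewrite ddivpowE.
Qed.

Lemma yuE a : yu p s u a = \prod_(i < n) (yj p s u i (a i) : A).
Proof. by []. Qed.

Lemma yu_mie i m : yu p s u (mie i m) = yj p s u i m.
Proof.
rewrite yuE (bigD1 i) //= mieE eqxx big1 ?mulr1 // => j /negPf neq_ji.
by rewrite mieE neq_ji (@yjE _ 0) // dpfam_ord0.
Qed.

Lemma yu_pexp i k : yu p s u (mie i (p ^ k)) = ypk p s u i k.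
Proof.
rewrite yu_mie (@yjE _ k.+1) ?ltn_exp2l ?prime_gt1 //.
by rewrite dpfam_pexp.
Qed.

Lemma yu_predn i k : yu p s u (mie i (p ^ k).-1) = P i k.
Proof.
by rewrite yu_mie (@yjE _ k) ?prednK ?expn_gt0 ?p_gt0 // dpfam_predn.
Qed.

(** By [yu_predn], what [uz] subtracts is exactly the integral added in [ypkE]. *)
Lemma uz_yu : uz p s (yu p s u) = u.
Proof.
apply/funext => i; apply/funext => k; rewrite /uz yu_pexp yu_predn ypkE.
exact: (@addrK A (iter q (dint i) (P i k)) (u i k)).
Qed.

Hypothesis Mu : inMns p s u.

(** The constant coefficient is zero: [u i k] has none by [Mu], and integrating [q > 0] times leaves
    none. *)
Lemma ypk_nilp i k : y i k ^+ p = 0.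
Proof.
apply: dser_nilp => //; rewrite ypkE -[LHS]/(u i k (mi0 n) + _) iter_dintE miE leqNgt q_gt0 addr0.
have [_ /(_ (mi0 n))] := Mu i k; case: eqVneq => // _ /(_ isT)[].
by rewrite eqxx.
Qed.

Let D_u i j k : D j (u i k) = 0.
Proof.
apply/funext => a; rewrite /D iter_ddeltaE; have [_ /(_ (miadd a (mie j q)))] := Mu i k.
case: eqVneq => [->//|_ /(_ isT)[_ /(_ j)]]; rewrite !miE eqxx.
by rewrite ltnNge leq_addl.
Qed.

Let DD j f g : D j (f + g) = D j f + D j g.
Proof. by have [linD _] := dD j; have := linD 1 f g; rewrite !scale1r. Qed.

Lemma iter_ddelta_ypk i k : D i (y i k) = P i k.
Proof. by rewrite ypkE DD D_u add0r /D iter_ddelta_dintK. Qed.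

(** [D j] commutes with integration in the other variable [i], and by strong induction it kills
    every factor of the integrand. *)
Lemma iter_ddelta_ypk_neq i j k : j != i -> D j (y i k) = 0.
Proof.
move=> neq_ji; elim/ltn_ind: k => k IHk; rewrite ypkE DD D_u add0r /D iter_ddelta_dintC //.
rewrite -/(D j _) (derivation_ker_prod (dD j)) ?iter_dint0 // => l _.
exact/derivation_ker_divpow/IHk.
Qed.

Lemma iter_ddelta_yj i j m :
  D j (yj p s u i m) = if (j == i) && (0 < m)%N then (yj p s u i m.-1 : A) else 0.
Proof.
have lt_m := ltn_expl m (prime_gt1 p_pr).
rewrite (yjE _ lt_m); case: eqVneq => [->|neq_ji] /=; last first.
  apply: derivation_ker_prod => // k _; apply: derivation_ker_divpow => //.
  exact: iter_ddelta_ypk_neq.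
(* With [w := 1] the required formula for the derivative of [y i k] is [iter_ddelta_ypk]. *)
rewrite (derivation_dpfam pcharKp (w := 1) (dD i)) //; last first.
- by move=> k; rewrite mul1r iter_ddelta_ypk.
- exact: ypk_nilp.
rewrite mul1r (@yjE _ m) //; exact: leq_ltn_trans (leq_pred m) lt_m.
Qed.

Lemma iter_ddelta_yu i a : D i (yu p s u a) = if (0 < a i)%N then (yu p s u (misub a (mie i 1)) : A) else 0.
Proof.
have [_ DM] := dD i; rewrite yuE (bigD1 i) //= DM iter_ddelta_yj eqxx /=.
have -> : D i (\prod_(j < n | j != i) (yj p s u j (a j) : A)) = 0.
  by apply: derivation_ker_prod => // j neq_ji; rewrite iter_ddelta_yj eq_sym (negPf neq_ji).
rewrite mulr0 addr0; case: ifP => _; last by rewrite mul0r.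
rewrite yuE [RHS](bigD1 i) //= !miE eqxx subn1; congr (_ * _).
by apply: eq_bigr => j /negPf neq_ji; rewrite !miE neq_ji subn0.
Qed.

Lemma yu_law a b :
  dmul (yu p s u a) (yu p s u b) = dscale (mibin (miadd a b) b)%:R (yu p s u (miadd a b)).
Proof.
rewrite -[LHS]/((yu p s u a : A) * yu p s u b) !yuE -big_split /= /mibin natr_prod.
rewrite -[RHS]/(_ *: (_ : A)) -scaler_prod; apply: eq_bigr => i _; rewrite miE.
(* A cutoff that serves all three exponents [a i], [b i] and [a i + b i]. *)
have lt_ab := ltn_expl (a i + b i) (prime_gt1 p_pr).
rewrite (yjE _ lt_ab) !(@yjE _ (a i + b i)) ?(leq_ltn_trans _ lt_ab) ?leq_addr ?leq_addl //.
by rewrite dpfamM // => k; apply: ypk_nilp.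
Qed.

Lemma yu_inD a : inD (yu p s u a).
Proof.
have inDy i k : inD (ypk p s u i k).
  elim/ltn_ind: k => k IHk; rewrite ypkE; apply: inD_add; first by case: (Mu i k).
  by apply/inD_iter_dint/inD_prod => l; apply/inD_divpow/IHk.
rewrite yuE; apply: inD_prod => i; rewrite (yjE _ (ltn_expl _ (prime_gt1 p_pr))).
by apply: inD_prod => k; apply: inD_divpow.
Qed.

Lemma yu_ddeltaP a b : ddeltaP q a (yu p s u b) =
  if mile a b then yu p s u (misub b a) else (fun _ => 0).
Proof.
apply/funext => c; rewrite ddeltaPE; elim/mi_ind: a b => [|a i IHa] b.
  have -> : mile (mi0 n) b by apply/forallP => j; rewrite miE.
  have -> : misub b (mi0 n) = b by apply/ffunP => j; rewrite !miE subn0.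
  by congr (yu _ _ _ _ _); apply/ffunP => j; rewrite ffunE miE addn0.
have -> : [ffun j => (c j + miadd a (mie i 1) j * q)%N] =
          miadd [ffun j => (c j + a j * q)%N] (mie i q).
  by apply/ffunP => j; rewrite !ffunE mulnDl addnA; case: eqP; rewrite ?mul1n.
rewrite -iter_ddeltaE -/(D i _) iter_ddelta_yu; case: ifP => [b_gt0|/negbT b_eq0]; last first.
  case: ifP => // /forallP/(_ i); rewrite !miE eqxx addn1 => /(leq_trans _) lt_b.
  by case/negP: b_eq0; apply: lt_b.
rewrite IHa; congr (_ c).
have -> : misub (misub b (mie i 1)) a = misub b (miadd a (mie i 1)).
  by apply/ffunP => j; rewrite !miE -subnDA addnC.
congr (if _ then _ else _); apply: eq_forallb => j; rewrite !miE.
by case: eqP => [->|_]; rewrite ?subn0 ?addn0 // addn1 subn1 -ltnS prednK.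
Qed.

Lemma yu_inID : inID p s (yu p s u).
Proof.
split; [exact: yu_inD | | exact: yu_law | exact: yu_ddeltaP].
by rewrite yuE big1 // => i _; rewrite miE (@yjE _ 0) // dpfam_ord0.
Qed.

End Forward.

(** * From families to matrices *)

Section Backward.
Variable z : mi n -> Dfun K n.
Hypothesis IDz : inID p s z.
Local Notation Z i j := (z (mie i j) : A).

Lemma inID_law i : divpow_law (fun j => Z i j).
Proof.
have [_ z0 zM _] := IDz; split=> [|r t].
  by rewrite (_ : mie i 0 = mi0 n) ?z0 //; apply/ffunP => j; rewrite !miE if_same.
rewrite -[LHS]/(dmul (z (mie i r)) (z (mie i t))) zM mibin_mie.
rewrite (_ : miadd _ _ = mie i (r + t)) //.
by apply/ffunP => j; rewrite !miE; case: eqP.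
Qed.

Lemma iter_ddelta_inID i j m : D j (Z i m) = if (j == i) && (0 < m)%N then Z i m.-1 else 0.
Proof.
have [_ _ _ /(_ (mie j 1) (mie i m)) zD] := IDz.
have -> : D j (Z i m) = ddeltaP q (mie j 1) (z (mie i m)).
  apply/funext => c; rewrite /D iter_ddeltaE ddeltaPE; congr (z _ _).
  by apply/ffunP => k; rewrite !ffunE; case: eqP; rewrite ?mul1n.
rewrite zD; have -> : mile (mie j 1) (mie i m) = (j == i) && (0 < m)%N.
  apply/forallP/andP => [/(_ j)|[/eqP-> m_gt0] k]; rewrite !miE.
    by rewrite eqxx; case: eqP.
  by case: eqP.
case: ifP => // /andP[/eqP-> _]; congr (z _); apply/ffunP => k; rewrite !miE.
by case: eqP; rewrite ?subn1.
Qed.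

Lemma uz_inMns : inMns p s (uz p s z).
Proof.
suff supp i k a : uz p s z i k a != 0 -> a != mi0 n /\ forall j, (a j < q)%N.
  by move=> i k; split; [exists q => a /supp[] | exact: supp].
move=> nz; split; last first.
  move=> j; apply: ddelta_supp nz; rewrite -/(D j _).
  have [linD _] := dD j.
  (* The difference is put in the shape c x + y of [linear]. For [j = i] the two images under [D j]
     cancel; for [j != i] each is zero. *)
  have -> : uz p s z i k = - 1 *: (iter q (dint i) (Z i (p ^ k).-1) : A) + Z i (p ^ k)%N.
    by rewrite scaleN1r addrC.
  rewrite linD iter_ddelta_inID expn_gt0 p_gt0 andbT.
  case: eqVneq => [->|neq_ji]; first by rewrite /D iter_ddelta_dintK scaleN1r addNr.
  by rewrite /D iter_ddelta_dintC // -/(D j _) iter_ddelta_inID (negPf neq_ji) /= iter_dint0 scaler0 addr0.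
(* The integral has no constant coefficient, and that of z_i^[p^k] is a nilpotent element of a
   field. *)
apply: contraNneq nz => ->; rewrite /uz /dsub iter_dintE miE leqNgt q_gt0 subr0.
have := congr1 (fun f : A => f (mi0 n)) (divpow_law_nilp pcharKp k (inID_law i)).
by rewrite dser_mi0X => /eqP; rewrite expf_eq0 p_gt0.
Qed.

(** Strong induction: once the earlier members agree with those of [z], the integrand is
    z_i^[p^k - 1], and the recursion adds back the integral that [uz] subtracts. *)
Lemma ypk_uz i k : ypk p s (uz p s z) i k = Z i (p ^ k)%N.
Proof.
elim/ltn_ind: k => k IHk; rewrite ypkE.
have -> : \prod_(l < k) divpow p.-1 (ypk p s (uz p s z) i l : A) = Z i (p ^ k).-1.
  rewrite -(divpow_law_dpfam pcharKp (N := k) (inID_law i)) ?prednK ?expn_gt0 ?p_gt0 //.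
  by rewrite dpfam_predn //; apply: eq_bigr => l _; rewrite IHk.
exact: (@subrK A).
Qed.

Lemma inID_prod a : z a = \prod_(i < n) Z i (a i).
Proof.
have [_ z0 zM _] := IDz.
have prodE (r : seq 'I_n) : uniq r ->
    \prod_(i <- r) Z i (a i) = z [ffun j => if j \in r then a j else 0%N].
  elim: r => [_|i r IHr /= /andP[/negPf ir ur]].
    by rewrite big_nil (_ : [ffun _ => _] = mi0 n) ?z0 //; apply/ffunP => j; rewrite !ffunE.
  rewrite big_cons IHr // -[LHS]/(dmul (z _) (z _)) zM.
  (* The two indices have disjoint supports, so every coordinate contributes 'C(m, 0) or 'C(m,
     m). *)
  set b := [ffun j => _]; rewrite (_ : mibin _ _ = 1%N); last first.
    rewrite /mibin big1 // => j _; rewrite !ffunE.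
    by case: eqP => [->|_]; rewrite ?ir ?bin0 // add0n binn.
  rewrite -[LHS]/(1 *: (z _ : A)) scale1r; congr (z _); apply/ffunP => j; rewrite !ffunE in_cons.
  by case: eqP => [->|_]; rewrite ?ir ?addn0.
rewrite prodE ?index_enum_uniq //; congr (z _); apply/ffunP => j.
by rewrite ffunE mem_index_enum.
Qed.

Lemma yu_uz : yu p s (uz p s z) = z.
Proof.
apply/funext => a; rewrite inID_prod yuE; apply: eq_bigr => i _.
rewrite (yjE _ _ (ltn_expl _ (prime_gt1 p_pr))).
rewrite -[RHS](divpow_law_dpfam pcharKp (inID_law i) (ltn_expl _ (prime_gt1 p_pr))).
by apply: eq_bigr => k _; rewrite ypk_uz.
Qed.

End Backward.
End Family.

Theorem theorem5p1 (K : fieldType) (p : nat) (n s : nat) :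
  p \in [pchar K] -> (1 <= s)%N ->
  (forall u : 'I_n -> nat -> Dfun K n, inMns p s u -> inID p s (yu p s u)) /\
  (forall z : mi n -> Dfun K n, inID p s z -> inMns p s (uz p s z) /\ yu p s (uz p s z) = z) /\
  (forall u : 'I_n -> nat -> Dfun K n, inMns p s u -> uz p s (yu p s u) = u).
Proof.
move=> pcharKp _; split; first by move=> u; apply: yu_inID.
by split=> [z IDz|u _]; [split; [apply: uz_inMns | apply: yu_uz] | apply: uz_yu].
Qed.
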